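(* Let $\varphi\in\mathsf{LTL_f}(\mathcal{P})$ with $\mathcal{P}=\mathcal{P}_o\uplus\mathcal{P}_u$, and let $\mathcal{S}$ be the state set of the belief-state DFA $\mathcal{A}^B_\varphi$ of $\varphi$. Then $\mathcal{S}$ is finite and $|\mathcal{S}|=O(2^{2^{n}})$, where $n=|\mathsf{sf}(\varphi)|$ is the number of subformulas of $\varphi$.
   Context: $\mathbb{B}=\{\bot,\top\}$; assignments $w:\mathcal{P}\to\mathbb{B}$ (identified with the set of true propositions); $w|_{\mathcal{P}_o}$ is restriction. $\mathsf{LTL_f}(\mathcal{P})$ formulas: $\varphi::=\mathit{tt}\mid\mathit{ff}\mid p\mid\neg\varphi\mid\varphi\odot\varphi\mid \mathsf{X}\varphi\mid\mathsf{X}^{s}\varphi\mid\mathsf{F}\varphi\mid\mathsf{G}\varphi\mid\varphi\,\mathsf{U}\,\varphi\mid\varphi\,\mathsf{R}\,\varphi$ ($\odot$ a binary Boolean connective). $\mathsf{sf}(\varphi)$ is the set of subformulas of $\varphi$. Propositional equivalence $\sim$: replace each maximal temporal subformula $\psi$ (one whose main operator is temporal and not strictly inside another temporal subformula) by a fresh Boolean variable $x_\psi$; two formulas are $\sim$-equivalent iff the resulting Boolean formulas are semantically equivalent. $[\varphi]_\sim$ is a fixed unique representative of the $\sim$-class. Pairs: $(\varphi_1,b_1)\odot(\varphi_2,b_2)=([\varphi_1\odot\varphi_2]_\sim,b_1\odot b_2)$, $\neg(\varphi,b)=([\neg\varphi]_\sim,\neg b)$, $\bigwedge X=(\bigwedge_{(\varphi,b)\in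 X}\varphi,\bigwedge_{(\varphi,b)\in X}b)$. Formula progression $\mathrm{fp}(\varphi,w)$: $\mathrm{fp}(\mathit{tt},w)=(\mathit{tt},\top)$, $\mathrm{fp}(\mathit{ff},w)=(\mathit{ff},\bot)$; $\mathrm{fp}(p,w)=(\mathit{tt},\top)$ if $p\in w$, else $(\mathit{ff},\bot)$; $\mathrm{fp}(\neg\varphi,w)=\neg\mathrm{fp}(\varphi,w)$; $\mathrm{fp}(\varphi_1\odot\varphi_2,w)=\mathrm{fp}(\varphi_1,w)\odot\mathrm{fp}(\varphi_2,w)$; $\mathrm{fp}(\mathsf{X}\varphi,w)=(\varphi,\top)$; $\mathrm{fp}(\mathsf{X}^s\varphi,w)=(\varphi,\bot)$; $\mathrm{fp}(\mathsf{F}\varphi,w)=\mathrm{fp}(\varphi,w)\vee(\mathsf{F}\varphi,\bot)$; $\mathrm{fp}(\mathsf{G}\varphi,w)=\mathrm{fp}(\varphi,w)\wedge(\mathsf{G}\varphi,\top)$; $\mathrm{fp}(\varphi_1\mathsf{U}\varphi_2,w)=\mathrm{fp}(\varphi_2,w)\vee(\mathrm{fp}(\varphi_1,w)\wedge(\varphi_1\mathsf{U}\varphi_2,\bot))$; $\mathrm{fp}(\varphi_1\mathsf{R}\varphi_2,w)=\mathrm{fp}(\varphi_2,w)\wedge(\mathrm{fp}(\varphi_1,w)\vee(\varphi_1\mathsf{R}\varphi_2,\top))$. Observable progression: $\mathrm{fp}_{\mathrm{obs}}(\psi,w_o)=\bigwedge\{\mathrm{fp}(\psi,w)\mid w\in\mathbb{B}^{\mathcal{P}},\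 w|_{\mathcal{P}_o}=w_o\}$ for $w_o\in\mathbb{B}^{\mathcal{P}_o}$, extended to nonempty words $\sigma_o\in(\mathbb{B}^{\mathcal{P}_o})^+$ by iterating on the first component. The state set of the belief-state DFA is $\mathcal{S}=\{[\varphi]_\sim\}\cup\{[\psi']_\sim\mid(\psi',\_)=\mathrm{fp}_{\mathrm{obs}}(\varphi,\sigma_o),\ \sigma_o\in(\mathbb{B}^{\mathcal{P}_o})^+\}$. *)

(* Defs.v *)
From HB Require Import structures.
From mathcomp Require Import all_boot finmap.
From mathcomp Require Import boolp classical_sets cardinality.

Set Implicit Arguments.
Unset Strict Implicit.
Unset Printing Implicit Defensive.

Local Open Scope classical_set_scope.

(* A binary Boolean connective is given by its truth table, so that all
   sixteen of them are available. *)
Definition connective := {ffun bool * bool -> bool}.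

Definition con_and : connective := [ffun b => b.1 && b.2].
Definition con_or : connective := [ffun b => b.1 || b.2].

(* Next is the weak next operator X, SNext the strong one X^s. *)
Inductive formula (P : Type) : Type :=
| TT
| FF
| Atom of P
| Neg of formula P
| Bin of connective & formula P & formula P
| Next of formula P
| SNext of formula P
| Ev of formula P
| Alw of formula P
| Until of formula P & formula P
| Release of formula P & formula P.

Arguments TT {P}.
Arguments FF {P}.

Section FormulaChoice.
Variable P : Type.

Fixpoint formula_encode (f : formula P) : GenTree.tree (P + connective) :=
  match f with
  | TT => GenTree.Node 0 [::]
  | FF => GenTree.Node 1 [::]
  | Atom p => GenTree.Leaf (inl p)
  | Neg a => GenTree.Node 2 [:: formula_encode a]
  | Bin c a b =>
      GenTree.Node 3 [:: GenTree.Leaf (inr c); formula_encode a; formula_encode b]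
  | Next a => GenTree.Node 4 [:: formula_encode a]
  | SNext a => GenTree.Node 5 [:: formula_encode a]
  | Ev a => GenTree.Node 6 [:: formula_encode a]
  | Alw a => GenTree.Node 7 [:: formula_encode a]
  | Until a b => GenTree.Node 8 [:: formula_encode a; formula_encode b]
  | Release a b => GenTree.Node 9 [:: formula_encode a; formula_encode b]
  end.

Fixpoint formula_decode (t : GenTree.tree (P + connective)) :
    option (formula P) :=
  match t with
  | GenTree.Node 0 [::] => Some TT
  | GenTree.Node 1 [::] => Some FF
  | GenTree.Leaf (inl p) => Some (Atom p)
  | GenTree.Node 2 [:: a] => omap (@Neg P) (formula_decode a)
  | GenTree.Node 3 [:: GenTree.Leaf (inr c); a; b] =>
      if (formula_decode a, formula_decode b) is (Some a', Some b')
      then Some (Bin c a' b') else None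
  | GenTree.Node 4 [:: a] => omap (@Next P) (formula_decode a)
  | GenTree.Node 5 [:: a] => omap (@SNext P) (formula_decode a)
  | GenTree.Node 6 [:: a] => omap (@Ev P) (formula_decode a)
  | GenTree.Node 7 [:: a] => omap (@Alw P) (formula_decode a)
  | GenTree.Node 8 [:: a; b] =>
      if (formula_decode a, formula_decode b) is (Some a', Some b')
      then Some (Until a' b') else None
  | GenTree.Node 9 [:: a; b] =>
      if (formula_decode a, formula_decode b) is (Some a', Some b')
      then Some (Release a' b') else None
  | _ => None
  end.

Lemma formula_encodeK : pcancel formula_encode formula_decode.
Proof.
by elim=> //= [a ->|c a -> b ->|a ->|a ->|a ->|a ->|a -> b ->|a -> b ->].
Qed.

End FormulaChoice.

HB.instance Definition _ (P : choiceType) :=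
  Choice.copy (formula P) (pcan_type (@formula_encodeK P)).

Fixpoint sf (P : choiceType) (f : formula P) : {fset formula P} :=
  (f |` match f with
        | TT | FF | Atom _ => fset0
        | Neg a | Next a | SNext a | Ev a | Alw a => sf a
        | Bin _ a b | Until a b | Release a b => sf a `|` sf b
        end)%fset.

Inductive bformula (V : Type) : Type :=
| BTrue
| BFalse
| BVar of V
| BNeg of bformula V
| BBin of connective & bformula V & bformula V.

Arguments BTrue {V}.
Arguments BFalse {V}.

Fixpoint beval (V : Type) (v : V -> bool) (g : bformula V) : bool :=
  match g with
  | BTrue => true
  | BFalse => false
  | BVar x => v x
  | BNeg a => ~~ beval v a
  | BBin c a b => c (beval v a, beval v b)
  end.

(* The recursion stops at the first temporal operator met on each branch, so
   the formulas psi turned into variables [inr psi] are exactly the maximal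
   temporal subformulas; [inl p] is the proposition p itself. *)
Fixpoint skeleton (P : Type) (f : formula P) : bformula (P + formula P) :=
  match f with
  | TT => BTrue
  | FF => BFalse
  | Atom p => BVar (inl p)
  | Neg a => BNeg (skeleton a)
  | Bin c a b => BBin c (skeleton a) (skeleton b)
  | Next _ | SNext _ | Ev _ | Alw _ | Until _ _ | Release _ _ => BVar (inr f)
  end.

Definition prop_equiv (P : Type) (f g : formula P) : Prop :=
  forall v : P + formula P -> bool, beval v (skeleton f) = beval v (skeleton g).

(* Any choice of one formula in each class of ~ is allowed. *)
Definition representative (P : Type) (rep : formula P -> formula P) : Prop :=
  (forall f, prop_equiv (rep f) f) /\
  (forall f g, prop_equiv f g -> rep f = rep g).

Lemma representative_exists (P : choiceType) :
  exists rep : formula P -> formula P, representative rep.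
Proof.
exists (fun f => xget TT [set g | prop_equiv g f]); split=> [f | f g fg].
  by case: xgetP => [g _ // | /(_ f)[]].
congr xget; apply/seteqP; split=> h /= hf v; first by rewrite hf fg.
by rewrite hf fg.
Qed.

Section Progression.
Variables (P : finType) (rep : formula P -> formula P).

Definition assignment (Q : finType) := {ffun Q -> bool}.

Definition pbin (c : connective) (x y : formula P * bool) : formula P * bool :=
  (rep (Bin c x.1 y.1), c (x.2, y.2)).

Definition pneg (x : formula P * bool) : formula P * bool :=
  (rep (Neg x.1), ~~ x.2).

(* Conjunction of a finite set of pairs, taken in the enumeration order of
   the set and ending with TT; order, bracketing and the final TT are
   immaterial up to ~ . *)
Definition pbigand (X : {fset formula P * bool}) : formula P * bool :=
  (\big[Bin con_and/TT]_(x <- X) x.1, \big[andb/true]_(x <- X) x.2).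

Fixpoint fp (f : formula P) (w : assignment P) : formula P * bool :=
  match f with
  | TT => (TT, true)
  | FF => (FF, false)
  | Atom p => if w p then (TT, true) else (FF, false)
  | Neg a => pneg (fp a w)
  | Bin c a b => pbin c (fp a w) (fp b w)
  | Next a => (a, true)
  | SNext a => (a, false)
  | Ev a => pbin con_or (fp a w) (f, false)
  | Alw a => pbin con_and (fp a w) (f, true)
  | Until a b => pbin con_or (fp b w) (pbin con_and (fp a w) (f, false))
  | Release a b => pbin con_and (fp b w) (pbin con_or (fp a w) (f, true))
  end.

Variable Po : {set P}.

Definition observation := assignment {p : P | p \in Po}.

Definition restrict (w : assignment P) : observation := [ffun p => w (val p)].

Definition fp_obs (f : formula P) (wo : observation) : formula P * bool :=
  pbigand [fset fp f w | w in [set w | restrict w == wo]%SET]%fset.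

(* Progression through the nonempty word [wo :: s]. *)
Fixpoint fp_obs_word (f : formula P) (wo : observation) (s : seq observation) :
    formula P * bool :=
  match s with
  | [::] => fp_obs f wo
  | wo' :: s' => fp_obs_word (fp_obs f wo).1 wo' s'
  end.

Definition belief_states (f : formula P) : set (formula P) :=
  [set rep f] `|`
  [set g | exists (wo : observation) (s : seq observation),
             g = rep (fp_obs_word f wo s).1].

End Progression.

(* Main.v *)
(** Up to ~, progression commutes with the Boolean connectives, so modulo ~
    it acts on a formula by substitution for the variables of its skeleton.
    Substituting for a variable that comes from a subformula of [phi] yields a
    formula that again only involves such variables. Hence each state is,
    modulo ~, a Boolean function of at most [n = #|sf phi|] variables, and there
    are [2 ^ (2 ^ n)] of those. *)
Require Import Defs.
From HB Require Import structures.
From mathcomp Require Import all_boot finmap.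
From mathcomp Require Import boolp classical_sets cardinality.

Set Implicit Arguments.
Unset Strict Implicit.
Unset Printing Implicit Defensive.

Section Variables.
Variable P : choiceType.
Implicit Types (f g : formula P) (v : P + formula P -> bool).
Implicit Type A : {fset formula P}.

(* The inverse of [var_of] on the variables that occur in skeletons; there
   [inr (Atom p)], which would collide with [inl p], never occurs. *)
Definition of_var (x : P + formula P) : formula P :=
  match x with inl p => Atom p | inr f => f end.

Definition var_of f : P + formula P := if f is Atom p then inl p else inr f.

Lemma var_ofK : cancel var_of of_var.
Proof. by case. Qed.

Definition agree A v v' := {in A, forall f, v (var_of f) = v' (var_of f)}.

(** Semantic rather than syntactic, hence invariant under ~ : [rep] may pick a representative in
    which variables outside [A] occur vacuously. *)
Definition depends_only_on A f :=
  forall v v', agree A v v' -> beval v (skeleton f) = beval v' (skeleton f).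

Lemma sf_trans f g : f \in sf g -> (sf f `<=` sf g)%fset.
Proof.
elim: g => [||p|a IH|c a IHa b IHb|a IH|a IH|a IH|a IH|a IHa b IHb|a IHa b IHb];
  rewrite inE => /orP[/fset1P-> //|]; rewrite ?inE //;
  try (move/IH => h); try (case/orP => [/IHa|/IHb] => h);
  apply: fsubset_trans h _; apply/fsubsetP => x hx; rewrite /= !inE hx ?orbT //.
Qed.

(** The skeleton of a temporal formula is a single variable, the formula itself, which lies in its
    own [sf]. *)
Lemma depends_only_on_sf f A : (sf f `<=` A)%fset -> depends_only_on A f.
Proof.
move=> + v v' vv'; elim: f => /=.
- by [].
- by [].
- by move=> p sA; apply: (vv' (Atom p)); apply: (fsubsetP sA); rewrite !inE eqxx.
- by move=> a IH; rewrite fsubUset => /andP[_ /IH ->].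
- by move=> c a IHa b IHb; rewrite !fsubUset => /and3P[_ /IHa -> /IHb ->].
- by move=> a _; rewrite fsubUset fsub1set => /andP[/vv'].
- by move=> a _; rewrite fsubUset fsub1set => /andP[/vv'].
- by move=> a _; rewrite fsubUset fsub1set => /andP[/vv'].
- by move=> a _; rewrite fsubUset fsub1set => /andP[/vv'].
- by move=> a _ b _; rewrite fsubUset fsub1set => /andP[/vv'].
- by move=> a _ b _; rewrite fsubUset fsub1set => /andP[/vv'].
Qed.

Lemma depends_only_on_equiv A f g :
  prop_equiv f g -> depends_only_on A g -> depends_only_on A f.
Proof. by move=> fg gA v v' vv'; rewrite !fg (gA _ _ vv'). Qed.

Lemma depends_only_on_neg A f :
  depends_only_on A f -> depends_only_on A (Neg f).
Proof. by move=> fA v v' vv' /=; rewrite (fA _ _ vv'). Qed.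

Lemma depends_only_on_bin A c f g :
  depends_only_on A f -> depends_only_on A g -> depends_only_on A (Bin c f g).
Proof. by move=> fA gA v v' vv' /=; rewrite (fA _ _ vv') (gA _ _ vv'). Qed.

Section TruthTable.
Variable A : {fset formula P}.

(** The default [false] outside [A] is invisible to formulas that depend only on [A]. *)
Definition extend (e : {ffun A -> bool}) (x : P + formula P) : bool :=
  if insub (of_var x) is Some a then e a else false.

Definition truth_table f : {ffun {ffun A -> bool} -> bool} :=
  [ffun e => beval (extend e) (skeleton f)].

(** Every valuation agrees on [A] with the extension of its restriction to [A], so the table already
    determines all values of the formula. *)
Lemma truth_table_equiv f g :
  depends_only_on A f -> depends_only_on A g ->
  truth_table f = truth_table g -> prop_equiv f g.
Proof.
move=> fA gA fg v; pose e := [ffun a : A => v (var_of (val a))].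
have ve : agree A v (extend e).
  by move=> a aA; rewrite /extend var_ofK insubT ffunE.
by rewrite (fA _ _ ve) (gA _ _ ve); move/ffunP/(_ e): fg; rewrite !ffunE.
Qed.

End TruthTable.
End Variables.

Section Progression.
Variables (P : finType) (rep : formula P -> formula P).
Hypothesis repP : representative rep.
Implicit Types (f g : formula P) (w : assignment P) (A : {fset formula P}).

Lemma rep_equiv f : prop_equiv (rep f) f.
Proof. by case: repP. Qed.

(** The valuation that corresponds to substituting for each variable its progression under [w]. *)
Definition progress_val w (v : P + formula P -> bool) (x : P + formula P) :=
  beval v (skeleton (fp rep (of_var x) w).1).

Lemma beval_fp f w v :
  beval v (skeleton (fp rep f w).1) = beval (progress_val w v) (skeleton f).
Proof.
elim: f => //= [a IH|c a IHa b IHb].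
  by rewrite rep_equiv /= IH.
by rewrite rep_equiv /= IHa IHb.
Qed.

Lemma depends_only_on_pbin A c (x y : formula P * bool) :
  depends_only_on A x.1 -> depends_only_on A y.1 ->
  depends_only_on A (pbin rep c x y).1.
Proof.
move=> xA yA; apply: depends_only_on_equiv (rep_equiv _) _.
exact: depends_only_on_bin.
Qed.

(** Unfolding a temporal operator brings in only [f] itself, its immediate subformulas and their
    progressions. *)
Lemma depends_only_on_fp_sf f w : depends_only_on (sf f) (fp rep f w).1.
Proof.
(* With an arbitrary larger set [A], the induction hypotheses for all subformulas speak of the same
   set. *)
suff H A : (sf f `<=` A)%fset -> depends_only_on A (fp rep f w).1 by exact: H.
elim: f => [||p|a IH|c a IHa b IHb|a _|a _|a IH|a IH|a IHa b IHb|a IHa b IHb] sA.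
- by [].
- by [].
- by rewrite /=; case: (w p).
- apply: depends_only_on_equiv (rep_equiv _) _; apply: depends_only_on_neg.
  by apply: IH; apply: fsubset_trans sA; apply: fsubsetUr.
all: have fA := depends_only_on_sf sA; rewrite /= ?fsubUset in sA;
  case/andP: sA => _.
- by case/andP => /IHa aA /IHb bA; apply: depends_only_on_pbin.
- exact: depends_only_on_sf.
- exact: depends_only_on_sf.
- by move=> /IH aA; apply: depends_only_on_pbin.
- by move=> /IH aA; apply: depends_only_on_pbin.
- case/andP => /IHa aA /IHb bA; apply: depends_only_on_pbin => //.
  exact: depends_only_on_pbin.
- case/andP => /IHa aA /IHb bA; apply: depends_only_on_pbin => //.
  exact: depends_only_on_pbin.
Qed.

(** Here [f] need not be a subformula of [phi]. By [beval_fp] it suffices that the progression of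
    each variable [a] in [sf phi] depends only on [sf a], a subset of [sf phi]. *)
Lemma depends_only_on_fp phi f w :
  depends_only_on (sf phi) f -> depends_only_on (sf phi) (fp rep f w).1.
Proof.
move=> fA v v' vv'; rewrite !beval_fp; apply: fA => a aphi.
rewrite /progress_val var_ofK; apply: depends_only_on_fp_sf => b ba.
by apply: vv'; apply: (fsubsetP (sf_trans aphi)).
Qed.

Lemma depends_only_on_pbigand A (X : {fset formula P * bool}) :
  (forall x, x \in X -> depends_only_on A x.1) ->
  depends_only_on A (pbigand X).1.
Proof.
move=> XA; rewrite /pbigand /= big_seq.
by elim/big_ind: _ => // *; apply: depends_only_on_bin.
Qed.

Variable Po : {set P}.

Lemma depends_only_on_fp_obs phi f (wo : observation Po) :
  depends_only_on (sf phi) f -> depends_only_on (sf phi) (fp_obs rep f wo).1.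
Proof.
move=> fA; apply: depends_only_on_pbigand => _ /imfsetP[w _ ->].
exact: depends_only_on_fp.
Qed.

Lemma depends_only_on_fp_obs_word phi f (wo : observation Po) s :
  depends_only_on (sf phi) f ->
  depends_only_on (sf phi) (fp_obs_word rep f wo s).1.
Proof.
elim: s f wo => [|wo' s IH] f wo fA /=; first exact: depends_only_on_fp_obs.
by apply: IH; apply: depends_only_on_fp_obs.
Qed.

Lemma belief_states_rep phi g :
  belief_states rep Po phi g ->
  exists2 f, g = rep f & depends_only_on (sf phi) f.
Proof.
have phiA : depends_only_on (sf phi) phi by exact: depends_only_on_sf.
case=> [->|[wo [s ->]]]; first by exists phi.
by exists (fp_obs_word rep phi wo s).1 => //; apply: depends_only_on_fp_obs_word.
Qed.

Lemma truth_table_belief_states_inj phi :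
  {in belief_states rep Po phi &, injective (truth_table (sf phi))}.
Proof.
move=> _ _ /set_mem/belief_states_rep[f -> fA] /set_mem/belief_states_rep[g -> gA].
have rA h : depends_only_on (sf phi) h -> depends_only_on (sf phi) (rep h).
  exact: depends_only_on_equiv (rep_equiv h).
move/(truth_table_equiv (rA _ fA) (rA _ gA)) => fg.
(* Both states are values of [rep], so their equivalence gives that of [f] and [g], and [rep] is
   constant on classes. *)
by case: repP => _; apply=> v; rewrite -[LHS]rep_equiv fg rep_equiv.
Qed.

End Progression.

Lemma finite_inj_card (T : choiceType) (U : finType) (S : set T) (h : T -> U) :
  {in S &, injective h} -> finite_set S /\ #|` fset_set S| <= #|U|.
Proof.
move=> hI.
(* Finiteness comes first: [fset_set] lists the elements of [S] only when [S] is finite. *)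
have finS : finite_set S.
  by rewrite -(eq_finite_set (inj_card_eq hI)); apply: finite_finset.
have hI' : {in fset_set S &, injective h}.
  by move=> x y; rewrite !in_fset_set //; apply: hI.
split=> //; rewrite -(card_in_imfset imfset_key hI') -(card_uniqP (fset_uniq _)).
exact: max_card.
Qed.

Theorem theorem2 :
  exists C : nat,
    forall (P : finType) (Po Pu : {set P}),
      Po :|: Pu = [set: P]%SET -> [disjoint Po & Pu] ->
    forall rep : formula P -> formula P, representative rep ->
    forall phi : formula P,
      finite_set (belief_states rep Po phi) /\
      #|` fset_set (belief_states rep Po phi)| <= C * 2 ^ (2 ^ #|` sf phi|).
Proof.
(* The constant is 1, since there are exactly [2 ^ (2 ^ n)] truth tables over the [n] elements of
   [sf phi]. *)
exists 1 => P Po Pu _ _ rep repP phi.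
have := finite_inj_card (truth_table_belief_states_inj repP (Po := Po) (phi := phi)).
by rewrite mul1n !card_ffun card_bool -cardfE.
Qed.
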